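(* Let $T$ be a bounded linear operator on a complex Hilbert space which is a $3$-isometry but is not an isometry. Then $T$ is not similar to any subnormal operator.
   Context: An operator $T\in\boldsymbol B(\mathcal H)$ is an $m$-isometry ($m\geqslant1$ an integer) if $\sum_{k=0}^m(-1)^k\binom mk T^{*k}T^k=0$. Operators $A\in\boldsymbol B(\mathcal H)$ and $S\in\boldsymbol B(\mathcal K)$ are similar if $XA=SX$ for some bijective bounded linear $X\colon\mathcal H\to\mathcal K$. *)

(* Defs.v *)
From HB Require Import structures.
From mathcomp Require Import all_boot all_order all_algebra.
From mathcomp Require Import boolp classical_sets functions reals topology normedtype.
From mathcomp Require Import complex.

Set Implicit Arguments.
Unset Strict Implicit.
Unset Printing Implicit Defensive.

Import Order.TTheory GRing.Theory Num.Theory Num.Def.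
Import numFieldNormedType.Exports.

Local Open Scope classical_set_scope.
Local Open Scope ring_scope.

(* A complex Hilbert space: a Banach space over R[i] whose norm comes from a
   positive definite hermitian form, linear in its first argument. *)
HB.mixin Record CompleteNormedModule_isHilbert (R : realType) H
    & CompleteNormedModule R[i] H := {
  dotp : {dot H for (@conjC R[i])} ;
  dotp_sqr_norm : forall x : H, dotp x x = `|x| ^+ 2
}.

#[short(type="hilbertType")]
HB.structure Definition Hilbert (R : realType) :=
  { H of CompleteNormedModule R[i] H & CompleteNormedModule_isHilbert R H }.

Notation "''[' u , v ]" := (dotp u v) : ring_scope.

Section operators.
Context {R : realType}.
Implicit Types H K L : hilbertType R.

(* Equivalent to \forall r \near +oo, forall x, `|T x| <= r * `|x|, by
   linear_boundedP. *)
Definition bounded_op H K (T : {linear H -> K}) : Prop :=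
  bounded_near T (nbhs (0 : H)).

(* adjoint T y is the unique z such that '[T x, y] = '[x, z] for all x; it
   exists for bounded T by the Riesz representation theorem, and the default
   value 0 is irrelevant in that case. *)
Definition adjoint H K (T : {linear H -> K}) (y : K) : H :=
  xget 0 [set z | forall x, '[T x, y] = '[x, z]].

Definition isometry_op H K (T : {linear H -> K}) : Prop :=
  forall x, `|T x| = `|x|.

Definition m_isometry (m : nat) H (T : {linear H -> H}) : Prop :=
  forall x, \sum_(0 <= k < m.+1)
    ((-1) ^+ k * 'C(m, k)%:R) *: iter k (adjoint T) (iter k T x) = 0.

Definition similar_op H K (A : {linear H -> H}) (S : {linear K -> K}) : Prop :=
  exists X : {linear H -> K},
    [/\ bounded_op X, bijective X & forall x, X (A x) = S (X x)].

Definition normal_op H (N : {linear H -> H}) : Prop :=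
  bounded_op N /\ forall x, N (adjoint N x) = adjoint N (N x).

(* S is, up to the isometric inclusion J of K in a larger Hilbert space L, the
   restriction to K of a normal operator on L. *)
Definition subnormal_op K (S : {linear K -> K}) : Prop :=
  exists (L : hilbertType R) (J : {linear K -> L}) (N : {linear L -> L}),
    [/\ isometry_op J, normal_op N & forall x, N (J x) = J (S x)].

End operators.

(* Main.v *)
Require Import Defs.
From mathcomp Require Import all_boot all_order all_algebra.
From mathcomp Require Import reals.
From mathcomp Require Import boolp classical_sets topology normedtype.
From mathcomp Require Import complex ring lra.

(** Write [X T = S X] with [X] bounded and bijective, and let the isometry [J]
    embed the space of [S] in that of a normal operator [N] extending [S].

    Growth. Since [T] is a 3-isometry, the third differences of
    [n |-> |T^n x|^2] vanish, so this sequence is a polynomial of degree at most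
    two in [n] ([three_isometry_orbit], [third_difference0]). Hence
    [|N^n J X x| = |S^n X x| = |X T^n x|] grows at most linearly.

    Convexity. For normal [N], [|N y|^2 <= |y| |N^2 y|] ([normal_logconvex]), so
    [n |-> |N^n y|] is log-convex: once it increases, it grows geometrically.
    With linear growth it can never increase ([logconvex_linear_growth]), so
    [|X T x| <= |X x|] for every [x].

    Conclusion. The inverse of [X] is bounded ([bounded_inverse]), so
    [|T^n x| <= c |X T^n x| <= c |X x|] for all [n]. A bounded polynomial in [n]
    is constant ([bounded_quadratic_const]), whence [|T x| = |x|] for all [x].

    Two facts of Hilbert space theory support this. The identity defining the
    adjoint comes from the Riesz representation theorem, itself a consequence of
    the orthogonal projection on a closed subspace. The boundedness of the
    inverse of [X] is obtained without Baire category: uniform boundedness,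
    proved by the gliding hump, makes the adjoint of [X] bounded below, and its
    range is then closed and has trivial orthogonal complement, hence is
    everything.

    All estimates use the underlying real Hilbert space, with inner product
    [Re '[x, y]] and an [R]-valued norm; this gives a totally ordered scalar
    field and loses nothing, as orthogonality to a complex subspace can be tested on
    real parts. *)

Set Implicit Arguments.
Unset Strict Implicit.
Unset Printing Implicit Defensive.

Import Order.TTheory GRing.Theory Num.Theory.
Import complex.

Local Open Scope ring_scope.

(** * The underlying real Hilbert space *)

Section RealStructure.
Local Open Scope complex_scope.
Local Open Scope classical_set_scope.
Context {R : realType}.
Implicit Types H K L : hilbertType R.

Definition rnorm H (x : H) : R := Re `|x|.
Definition rdot H (x y : H) : R := Re '[x, y].

Lemma Re_conj (z : R[i]) : Re (Num.conj z) = Re z.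
Proof. by case: z. Qed.

Lemma normE H (x : H) : `|x| = (rnorm x)%:C.
Proof. by rewrite /rnorm RRe_real// ger0_real. Qed.

Lemma rnorm_ge0 H (x : H) : 0 <= rnorm x.
Proof. by rewrite -lecR -normE; exact: normr_ge0. Qed.

Lemma rnorm0_eq0 H (x : H) : rnorm x = 0 -> x = 0.
Proof. by move=> x0; apply/normr0_eq0; rewrite normE x0. Qed.

Lemma rnorm0 H : rnorm (0 : H) = 0.
Proof. by rewrite /rnorm normr0. Qed.

Lemma rnormZ H (a : R) (x : H) : rnorm (a%:C *: x) = `|a| * rnorm x.
Proof.
apply: (@complexI R); rewrite rmorphM/= -!normE normrZ; congr (_ * _).
by rewrite normc_def/= expr0n addr0 sqrtr_sqr.
Qed.

Lemma rnormD H (x y : H) : rnorm (x + y) <= rnorm x + rnorm y.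
Proof. by rewrite -lecR rmorphD/= -!normE ler_normD. Qed.

Lemma rnormC H (x y : H) : rnorm (x - y) = rnorm (y - x).
Proof. by rewrite /rnorm distrC. Qed.

Lemma rdotC H (x y : H) : rdot x y = rdot y x.
Proof.
rewrite /rdot (hermC (dotp : {dot H for @Num.conj R[i]}) x y) expr0 mul1r.
exact: (Re_conj (dotp y x)).
Qed.

Lemma rdotDl H (x y z : H) : rdot (x + y) z = rdot x z + rdot y z.
Proof. by rewrite /rdot linearDl raddfD. Qed.

Lemma rdotZl H (a : R) (x z : H) : rdot (a%:C *: x) z = a * rdot x z.
Proof. by rewrite /rdot linearZl_LR /=; case: '[x, z] => u v /=; rewrite mul0r subr0. Qed.

Lemma rdotDr H (x y z : H) : rdot z (x + y) = rdot z x + rdot z y.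
Proof. by rewrite rdotC rdotDl !(rdotC z). Qed.

Lemma rdotZr H (a : R) (x z : H) : rdot z (a%:C *: x) = a * rdot z x.
Proof. by rewrite rdotC rdotZl rdotC. Qed.

Lemma rdotNr H (x z : H) : rdot z (- x) = - rdot z x.
Proof. by rewrite -scaleN1r -[-1](rmorphN1 (real_complex R)) rdotZr mulN1r. Qed.

Lemma rdotNl H (x z : H) : rdot (- x) z = - rdot x z.
Proof. by rewrite rdotC rdotNr rdotC. Qed.

Lemma rdotBl H (x y z : H) : rdot (x - y) z = rdot x z - rdot y z.
Proof. by rewrite rdotDl rdotNl. Qed.

Lemma rdotBr H (x y z : H) : rdot z (x - y) = rdot z x - rdot z y.
Proof. by rewrite rdotDr rdotNr. Qed.

Lemma rdot0l H (z : H) : rdot 0 z = 0.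
Proof. by rewrite -(subrr z) rdotBl subrr. Qed.

Lemma rdotxx H (x : H) : rdot x x = rnorm x ^+ 2.
Proof. by rewrite /rdot dotp_sqr_norm normE -rmorphXn. Qed.

Lemma rdot_inj H (x y : H) : (forall z, rdot z x = rdot z y) -> x = y.
Proof.
move=> xy; apply/eqP; rewrite -subr_eq0; apply/eqP/rnorm0_eq0/eqP.
by rewrite -sqrf_eq0 -rdotxx rdotBr xy subrr.
Qed.

(** Expand [| |y| x - |x| y |^2 >= 0]; applying the result to [-x] gives the
    absolute value. *)
Lemma CauchySchwarz_rdot H (x y : H) : `|rdot x y| <= rnorm x * rnorm y.
Proof.
have half (u v : H) : rdot u v <= rnorm u * rnorm v.
  have [u0|u0] := eqVneq (rnorm u) 0.
    by rewrite (rnorm0_eq0 u0) rdot0l rnorm0 mul0r.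
  have [v0|v0] := eqVneq (rnorm v) 0.
    by rewrite (rnorm0_eq0 v0) rdotC rdot0l rnorm0 mulr0.
  have uv0 : 0 < rnorm u * rnorm v by rewrite mulr_gt0// lt_neqAle eq_sym ?u0 ?v0 rnorm_ge0.
  have := sqr_ge0 (rnorm ((rnorm v)%:C *: u - (rnorm u)%:C *: v)).
  rewrite -rdotxx !(rdotBl, rdotBr, rdotZl, rdotZr) !rdotxx (rdotC v u) => h.
  rewrite -(ler_pM2l uv0); nra.
rewrite ler_norml half andbT lerNl -rdotNl.
by rewrite (le_trans (half _ _))// /rnorm normrN.
Qed.

Lemma parallelogram H (x y : H) :
  rnorm (x + y) ^+ 2 + rnorm (x - y) ^+ 2 = 2 * rnorm x ^+ 2 + 2 * rnorm y ^+ 2.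
Proof. rewrite -!rdotxx !(rdotBl, rdotBr, rdotDl, rdotDr); ring. Qed.

Lemma archimedean_le0 (a b : R) : (forall n : nat, a <= b * n.+1%:R^-1) -> a <= 0.
Proof.
move=> ab; rewrite leNgt; apply/negP => a0.
have := ab (Num.truncn (b / a)); rewrite ler_pdivlMr ?ltr0n// mulrC -ler_pdivlMr//.
by rewrite leNgt truncnS_gt.
Qed.

(** Completeness with an explicit rate: the error bound [e n] of the Cauchy
    condition passes to the limit, so that no filters are needed afterwards. *)
Lemma cauchy_limit H (u : nat -> H) (e : nat -> R) :
    (forall n m, (n <= m)%N -> rnorm (u m - u n) <= e n) ->
    (forall d, 0 < d -> exists n, e n < d) ->
  exists l, forall n, rnorm (l - u n) <= e n.
Proof.
move=> ue e0.
have cu : cvg (u @ \oo).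
  apply: cauchy_cvg; apply: cauchy_exP => d d0.
  have dR : d = (Re d)%:C by rewrite RRe_real// gtr0_real.
  have Rd0 : 0 < Re d by rewrite -ltcR -dR.
  have [n en] := e0 _ Rd0.
  exists (u n); exists n => // m /= nm.
  rewrite -ball_normE /ball_/= dR normE ltcR rnormC.
  exact: le_lt_trans (ue _ _ nm) en.
exists (lim (u @ \oo)) => n; apply/ler_addgt0Pr => d d0.
have /cvgrPdist_lt/(_ d%:C) := cu.
rewrite ltcR => /(_ d0) [N _ hN].
have := hN (maxn N n) (leq_maxl _ _); rewrite normE ltcR => /ltW h.
have -> : lim (u @ \oo) - u n = (lim (u @ \oo) - u (maxn N n)) + (u (maxn N n) - u n).
  by rewrite addrA subrK.
by rewrite (le_trans (rnormD _ _))// addrC lerD// ue// leq_maxr.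
Qed.

Lemma bounded_opP H K (T : {linear H -> K}) : bounded_op T ->
  exists2 M, 0 < M & forall x, rnorm (T x) <= M * rnorm x.
Proof.
move=> /linear_boundedP/pinfty_ex_gt0[r r0 rT].
have rR : r = (Re r)%:C by rewrite RRe_real// gtr0_real.
exists (Re r); first by rewrite -ltcR -rR.
by move=> x; rewrite -lecR rmorphM/= -rR -!normE.
Qed.
End RealStructure.

(** * Projections, the Riesz theorem and the adjoint identity *)

Section HilbertGeometry.
Local Open Scope complex_scope.
Local Open Scope classical_set_scope.
Context {R : realType}.
Implicit Types H K L : hilbertType R.

(** Closedness is sequential, and only sequences converging at the rate
    [1/(n+1)] are tested; every convergent sequence has such a subsequence.
    Linearity is over the reals. *)
Definition closed_subspace H (V : H -> Prop) : Prop :=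
  [/\ V 0, forall (a : R) x y, V x -> V y -> V (a%:C *: x + y)
    & forall u l, (forall n, V (u n)) ->
        (forall n, rnorm (l - u n) <= n.+1%:R^-1) -> V l].

Lemma harmonic_small (d : R) : 0 < d -> exists n, n.+1%:R^-1 < d.
Proof.
move=> d0; exists (Num.truncn d^-1).
by rewrite invf_plt ?posrE ?ltr0n// truncnS_gt.
Qed.

(** Minimize the distance from [x] to [V]. The parallelogram law makes a
    minimizing sequence Cauchy because midpoints stay in [V]; near-minimality
    under the perturbations [u n + a w] gives approximate orthogonality to [w],
    which becomes exact in the limit. *)
Lemma orthogonal_projection H (V : H -> Prop) (x : H) : closed_subspace V ->
  exists2 v, V v & forall w, V w -> rdot (x - v) w = 0.
Proof.
move=> [V0 VD Vcl].
pose E : set R := [set rnorm (x - v) ^+ 2 | v in [set v | V v]].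
have E0 : has_lbound E by exists 0 => _ [v _ <-]; exact: sqr_ge0.
have iE : has_inf E by split=> //; exists (rnorm (x - 0) ^+ 2), 0.
have dmin v : V v -> inf E <= rnorm (x - v) ^+ 2.
  by move=> Vv; apply: ge_inf => //; exists v.
pose e n : R := n.+1%:R^-1.
have e0 n : 0 < e n by rewrite invr_gt0 ltr0n.
(* The tolerance [(e n / 2)^2] is chosen so that the parallelogram law yields
   exactly [|u m - u n| <= e n]. *)
have exv n : exists v, V v /\ rnorm (x - v) ^+ 2 < inf E + (e n / 2) ^+ 2.
  have d0 : 0 < (e n / 2) ^+ 2 by rewrite exprn_gt0// divr_gt0.
  by have [_ [v Vv <-] vE] := inf_adherent d0 iE; exists v.
have [u uP] := boolp.choice exv.
have mid n m : V ((1 / 2)%:C *: (u n + u m)).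
  rewrite -[X in V X]addr0; apply: (VD) => //.
  by rewrite -(scale1r (u n)); apply: (VD (1 : R)); [exact: (uP n).1|exact: (uP m).1].
have ue n m : (n <= m)%N -> rnorm (u m - u n) <= e n.
  move=> nm; have enm : e m <= e n by rewrite lef_pV2 ?posrE ?ltr0n// ler_nat.
  have := parallelogram (x - u n) (x - u m).
  have -> : x - u n - (x - u m) = u m - u n.
    by rewrite opprB addrC subrKA.
  have -> : x - u n + (x - u m) = 2%:C *: (x - (1 / 2)%:C *: (u n + u m)).
    rewrite scalerBr scalerA -rmorphM/= mulrA mulr1 divff ?pnatr_eq0// scale1r.
    have -> : 2%:C *: x = x + x by rewrite (rmorphD _ 1 1) scalerDl !scale1r.
    by rewrite opprD addrACA.
  rewrite rnormZ exprMn ger0_norm//.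
  have := dmin _ (mid n m); have := (uP n).2; have := (uP m).2.
  have := e0 n; have := e0 m => hm hn h1 h2 h3 h4.
  have h5 : (e m / 2) ^+ 2 <= (e n / 2) ^+ 2.
    by nra.
  rewrite -ler_sqr ?nnegrE ?rnorm_ge0 ?(ltW (e0 _))//; lra.
have [v vP] := cauchy_limit ue (@harmonic_small).
exists v; first by apply: (Vcl u) => // n; exact: (uP n).1.
move=> w Vw; have [w0|w0] := eqVneq (rnorm w) 0.
  by rewrite (rnorm0_eq0 w0) rdotC rdot0l.
have w1 : 0 < rnorm w by rewrite lt_neqAle eq_sym w0 rnorm_ge0.
suff bd n : `|rdot (x - v) w| <= (2 * rnorm w) * n.+1%:R^-1.
  by apply/eqP; rewrite -normr_le0; exact: archimedean_le0 bd.
have h1 : `|rdot (x - u n) w| <= e n / 2 * rnorm w.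
  set r := rdot _ _.
  (* The multiple of [w] that minimizes the distance to [x - u n]. *)
  have := dmin _ (VD (r / rnorm w ^+ 2) _ _ Vw (uP n).1).
  have -> a : x - (a%:C *: w + u n) = (x - u n) - a%:C *: w.
    by rewrite opprD addrCA addrC.
  have := (uP n).2; rewrite {}/r; move: (x - u n) => y; set r := rdot y w.
  rewrite -[rnorm (y - _) ^+ 2]rdotxx !(rdotBl, rdotBr, rdotZl, rdotZr).
  rewrite (rdotC w y) -/r !rdotxx => h' h.
  have {}h : r ^+ 2 / rnorm w ^+ 2 < (e n / 2) ^+ 2.
    have E1 : r / rnorm w ^+ 2 * (r / rnorm w ^+ 2 * rnorm w ^+ 2) = r ^+ 2 / rnorm w ^+ 2.
      by field.
    have E2 : r / rnorm w ^+ 2 * r = r ^+ 2 / rnorm w ^+ 2 by field.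
    move: h; rewrite ?mulrBr E1 E2; lra.
  rewrite -ler_sqr ?nnegrE ?mulr_ge0 ?divr_ge0 ?(ltW (e0 _)) ?rnorm_ge0//.
  by rewrite real_normK ?num_real// exprMn -ler_pdivrMr ?exprn_gt0// ltW.
have h2 : `|rdot (u n - v) w| <= e n * rnorm w.
  rewrite (le_trans (CauchySchwarz_rdot _ _))// ler_pM2r//.
  by rewrite rnormC vP.
have -> : x - v = (x - u n) + (u n - v) by rewrite addrA subrK.
rewrite rdotDl (le_trans (ler_normD _ _))//.
have := e0 n; rewrite -/(e n); nra.
Qed.

(** The component [e] of a vector outside the kernel of [f] that is orthogonal
    to this kernel spans the orthogonal complement, on which [f] is a multiple
    of the inner product with [e]. *)
Lemma Riesz_real H (f : H -> R) (M : R) :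
    (forall (a : R) x y, f (a%:C *: x + y) = a * f x + f y) ->
    (forall x, `|f x| <= M * rnorm x) ->
  exists z, forall x, f x = rdot x z.
Proof.
move=> fD fM.
have f0 : f 0 = 0.
  by have := fD 1 0 0; rewrite scaler0 addr0 => ?; lra.
have fB x y : f (x - y) = f x - f y.
  have := fD (-1) y x; rewrite rmorphN1 scaleN1r addrC => ->; ring.
have M0 x : f x != 0 -> 0 < M.
  move=> fx; have : 0 < M * rnorm x by apply: lt_le_trans (fM x); rewrite normr_gt0.
  by have := rnorm_ge0 x; nra.
have [fz|/existsNP[x0 /eqP fx0]] := pselect (forall x, f x = 0).
  by exists 0 => x; rewrite fz rdotC rdot0l.
have [|v fv vP] := @orthogonal_projection _ (fun x => f x = 0) x0.
  split => [//|a x y fx fy|u l fu ul].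
    by rewrite fD fx fy mulr0 addr0.
  apply/eqP; rewrite -normr_le0; apply: (@archimedean_le0 _ _ M) => n.
  have -> : f l = f (l - u n) by rewrite fB fu subr0.
  by rewrite (le_trans (fM _))// ler_wpM2l// ltW// (M0 x0).
pose e := x0 - v.
have fe : f e != 0 by rewrite fB fv subr0.
have ee : rdot e e != 0.
  apply: contra fe; rewrite rdotxx sqrf_eq0 => /eqP/rnorm0_eq0 ->.
  by rewrite f0.
exists ((f e / rdot e e)%:C *: e) => x.
have : rdot e ((- (f x / f e))%:C *: e + x) = 0.
  by apply: vP; rewrite fD; field.
rewrite rdotDr !rdotZr (rdotC e x) => /eqP; rewrite addrC mulNr subr_eq0 => /eqP ->.
by field; rewrite fe; exact: ee.
Qed.

(** The Riesz vector of [x |-> Re '[T x, y]] represents the imaginary part too,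
    because [Im '[a, b] = - Re '['i a, b]] and [T] is complex linear; it thus
    satisfies the equation that defines [adjoint T y]. *)
Lemma adjointP H K (T : {linear H -> K}) : bounded_op T ->
  forall x y, rdot (T x) y = rdot x (adjoint T y).
Proof.
move=> /bounded_opP[M M0 TM] x y.
suff ex : exists z, forall x, '[T x, y] = '[x, z].
  by rewrite /rdot (xgetPex (0 : H) ex).
have [||z zP] := @Riesz_real H (fun x => rdot (T x) y) (M * rnorm y).
- by move=> a u v; rewrite linearP rdotDl rdotZl.
- move=> u; rewrite (le_trans (CauchySchwarz_rdot _ _))// mulrAC.
  by rewrite ler_wpM2r ?rnorm_ge0.
exists z => u.
have ImE L (a b : L) : Im '[a, b] = - rdot ('i%C *: a) b.
  by rewrite /rdot linearZl_LR /= mulrC ReiNIm opprK.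
apply/eqP; rewrite eq_complex; apply/andP; split; apply/eqP.
  exact: zP.
by rewrite !ImE -zP linearZ.
Qed.

End HilbertGeometry.

(** * Uniform boundedness and bounded inverses *)

Section BoundedInverse.
Local Open Scope complex_scope.
Context {R : realType}.
Implicit Types H K L : hilbertType R.

(** Gliding hump. If the norms in [P] were unbounded, pick [g n] in [P] of
    rapidly growing norm and add to the partial sum [u n] a multiple of [g n] of
    length [3^-(n+1)], with the sign that cannot decrease [|rdot (u n) (g n)|].
    The later steps have total length at most half of that one, so the limit [l]
    keeps [|rdot l (g n)|] above half of [3^-(n+1) |g n|], which is unbounded. *)
Lemma uniform_boundedness H (P : H -> Prop) :
    (forall y, exists C, forall g, P g -> rdot y g <= C) ->
  exists B, forall g, P g -> rnorm g <= B.
Proof.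
move=> Pbd; apply: contrapT => nB.
pose r n : R := (3^-1) ^+ n.
have r0 n : 0 < r n by rewrite exprn_gt0// invr_gt0.
have rS n : r n.+1 = r n / 3 by rewrite /r exprSr.
have exg n : exists g, P g /\ 2 * n.+1%:R / r n.+1 < rnorm g.
  apply: contrapT => ng; apply: nB; exists (2 * n.+1%:R / r n.+1) => g Pg.
  by rewrite leNgt; apply/negP => gt; apply: ng; exists g.
have [g gP] := boolp.choice exg.
have g0 n : 0 < rnorm (g n).
  by apply: le_lt_trans (gP n).2; rewrite divr_ge0 ?mulr_ge0 ?ler0n// ltW.
pose s n (y : H) : R := if 0 <= rdot y (g n) then 1 else -1.
pose u := fix u n := if n is n'.+1
  then (s n' (u n') * r n'.+1 / rnorm (g n'))%:C *: g n' + u n' else 0.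
have uS n : rnorm (u n.+1 - u n) = r n.+1.
  rewrite /= addrK rnormZ normrM normfV (gtr0_norm (g0 n)) divfK ?gt_eqF//.
  by rewrite normrM (gtr0_norm (r0 n.+1)) /s; case: ifP; rewrite ?normrN normr1 mul1r.
have ug n : r n.+1 * rnorm (g n) <= `|rdot (u n.+1) (g n)|.
  rewrite /= rdotDl rdotZl rdotxx expr2 mulrA divfK ?gt_eqF// -mulrA /s.
  have : 0 < r n.+1 * rnorm (g n) by rewrite mulr_gt0.
  move: (r n.+1 * _) (rdot _ _) => q b q0.
  case: (lerP 0 b) => h.
    by rewrite ger0_norm; lra.
  by rewrite ltr0_norm; lra.
(* [r n / 2] is the sum of the [r k] for [k > n]. *)
pose e n : R := r n / 2.
have ue n m : (n <= m)%N -> rnorm (u m - u n) <= e n.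
  move=> nm; suff : rnorm (u m - u n) <= e n - e m by have := r0 m; rewrite /e; lra.
  elim: m nm => [|m IH]; first by rewrite leqn0 => /eqP ->; rewrite !subrr rnorm0.
  rewrite leq_eqVlt ltnS => /predU1P[->|nm]; first by rewrite !subrr rnorm0.
  have -> : u m.+1 - u n = (u m.+1 - u m) + (u m - u n) by rewrite addrA subrK.
  have := rnormD (u m.+1 - u m) (u m - u n); have := IH nm.
  by rewrite uS /e rS; lra.
have esmall (d : R) : 0 < d -> exists n, e n < d.
  move=> /harmonic_small[n nd]; exists n; apply: le_lt_trans nd.
  have : r n <= n.+1%:R^-1.
    rewrite /r exprVn lef_pV2 ?posrE ?exprn_gt0 ?ltr0n//.
    by rewrite -natrX ler_nat ltn_expl.
  by move: (r0 n) (n.+1%:R^-1 : R) => rn a; rewrite /e; lra.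
have [l lP] := cauchy_limit ue esmall.
have [C1 C1P] := Pbd l; have [C2 C2P] := Pbd (- l).
pose C := Num.max C1 C2; pose n := Num.truncn C.
have lC : `|rdot l (g n)| <= C.
  rewrite ler_norml lerNl -rdotNl.
  by rewrite !le_max C1P ?C2P ?orbT//; exact: (gP n).1.
have Cn : C < n.+1%:R by exact: truncnS_gt.
have h1 : `|rdot (u n.+1 - l) (g n)| <= e n.+1 * rnorm (g n).
  rewrite (le_trans (CauchySchwarz_rdot _ _))// ler_pM2r//.
  by rewrite rnormC lP.
have h2 : `|rdot (u n.+1) (g n)| <= `|rdot l (g n)| + `|rdot (u n.+1 - l) (g n)|.
  by rewrite -{1}(subrK l (u n.+1)) rdotDl addrC ler_normD.
have := (gP n).2; rewrite ltr_pdivrMr// => h3.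
have := ug n; rewrite /e in h1; lra.
Qed.

Lemma adjoint_real_linear H K (X : {linear H -> K}) : bounded_op X ->
  forall (a : R) y z, adjoint X (a%:C *: y + z) = a%:C *: adjoint X y + adjoint X z.
Proof.
move=> Xb a y z; apply: rdot_inj => x.
by rewrite rdotDr rdotZr -!adjointP// rdotDr rdotZr.
Qed.

Lemma adjoint0 H K (X : {linear H -> K}) : bounded_op X -> adjoint X 0 = 0.
Proof.
by move=> Xb; apply: rdot_inj => x; rewrite -adjointP// rdotC rdot0l rdotC rdot0l.
Qed.

(** The vectors [g] with [|X^* g| <= 1] are weakly bounded, since every vector
    is of the form [X x] and [rdot (X x) g = rdot x (X^* g)]; so they are
    bounded in norm, and homogeneity concludes. *)
Lemma adjoint_bounded_below H K (X : {linear H -> K}) :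
    bounded_op X -> (forall y, exists x, X x = y) ->
  exists2 c, 0 < c & forall y, rnorm y <= c * rnorm (adjoint X y).
Proof.
move=> Xb Xsurj.
have [y|B Bge] := @uniform_boundedness K (fun g => rnorm (adjoint X g) <= 1).
  have [x <-] := Xsurj y; exists (rnorm x) => g g1.
  rewrite adjointP// (le_trans (ler_norm _))// (le_trans (CauchySchwarz_rdot _ _))//.
  by rewrite ler_piMr ?rnorm_ge0.
exists (`|B| + 1); first by rewrite ltr_wpDl.
move=> y; have [t0|t0] := eqVneq (rnorm (adjoint X y)) 0.
  have [x xy] := Xsurj y; suff : rnorm y ^+ 2 = 0.
    by move/eqP; rewrite sqrf_eq0 => /eqP ->; rewrite t0 mulr0.
  by rewrite -rdotxx -{1}xy adjointP// (rnorm0_eq0 t0) rdotC rdot0l.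
have t1 : 0 < rnorm (adjoint X y) by rewrite lt_neqAle eq_sym t0 rnorm_ge0.
have := Bge ((rnorm (adjoint X y))^-1%:C *: y).
rewrite -[_ *: y]addr0 adjoint_real_linear// adjoint0// !addr0 !rnormZ.
rewrite gtr0_norm ?invr_gt0// mulVf// => /(_ (lexx _)).
rewrite mulrC ler_pdivrMr// => h; apply: le_trans h _.
by rewrite ler_pM2r//; have := ler_norm B; lra.
Qed.

(** Being bounded below, [X^*] has closed range; being injective, [X] leaves
    nothing orthogonal to it. So [x = X^* z] with [|z| <= c |x|], and then
    [|x|^2 = rdot (X x) z <= c |X x| |x|]. *)
Lemma bounded_inverse H K (X : {linear H -> K}) : bounded_op X -> bijective X ->
  exists2 c, 0 < c & forall x, rnorm x <= c * rnorm (X x).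
Proof.
move=> Xb [Y XK YK].
have Xsurj y : exists x, X x = y by exists (Y y).
have [c c0 cP] := adjoint_bounded_below Xb Xsurj.
exists c => // x.
have [|_ [z <-] zP] := @orthogonal_projection R H (fun h => exists y, adjoint X y = h) x.
  split=> [|a _ _ [y <-] [z <-]|u l uP ul].
  - by exists 0; exact: adjoint0.
  - by exists (a%:C *: y + z); rewrite adjoint_real_linear.
  have [y yP] := boolp.choice uP.
  have yC n m : (n <= m)%N -> rnorm (y m - y n) <= c * 2 * n.+1%:R^-1.
    move=> nm; have -> : y m - y n = (-1)%:C *: y n + y m.
      by rewrite rmorphN1 scaleN1r addrC.
    rewrite (le_trans (cP _))// adjoint_real_linear// !yP rmorphN1 scaleN1r addrC.
    rewrite -mulrA ler_pM2l// -(subrKA l) (le_trans (rnormD _ _))//.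
    rewrite mulr_natl mulr2n lerD// rnormC (le_trans (ul m))//.
    by rewrite lef_pV2 ?posrE ?ltr0n// ler_nat.
  have [|z zP] := cauchy_limit yC.
    move=> d d0; have [|n nd] := @harmonic_small R (d / (c * 2)).
      by rewrite divr_gt0// mulr_gt0.
    by exists n; rewrite mulrC -ltr_pdivlMr// mulr_gt0.
  exists z; apply: rdot_inj => w; apply/eqP; rewrite -subr_eq0 -normr_le0.
  apply: (@archimedean_le0 _ _ (rnorm (X w) * (c * 2) + rnorm w)) => n.
  have -> : rdot w (adjoint X z) - rdot w l =
      rdot (X w) (z - y n) - rdot w (l - u n).
    by rewrite !rdotBr !adjointP// yP; ring.
  rewrite (le_trans (ler_normB _ _))// mulrDl lerD//.
    by rewrite (le_trans (CauchySchwarz_rdot _ _))// -mulrA ler_wpM2l ?rnorm_ge0.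
  by rewrite (le_trans (CauchySchwarz_rdot _ _))// ler_wpM2l ?rnorm_ge0.
have xz : x = adjoint X z.
  apply/eqP; rewrite -subr_eq0 -(inj_eq (can_inj XK)) linear0; apply/eqP.
  apply: rdot_inj => w; rewrite rdotC adjointP// zP; last by exists w.
  by rewrite rdotC rdot0l.
have [->|x0] := eqVneq (rnorm x) 0; first by rewrite mulr_ge0 ?rnorm_ge0// ltW.
have x1 : 0 < rnorm x by rewrite lt_neqAle eq_sym x0 rnorm_ge0.
rewrite -(ler_pM2r x1) -expr2 -rdotxx {2}xz -adjointP//.
rewrite (le_trans (ler_norm _))// (le_trans (CauchySchwarz_rdot _ _))//.
by rewrite -mulrA [leRHS]mulrCA ler_wpM2l ?rnorm_ge0// xz.
Qed.

End BoundedInverse.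

(** * Sequences of real numbers *)

Section Sequences.
Context {R : realType}.
Implicit Types a b : nat -> R.

(** Newton interpolation at 0, 1 and 2. *)
Lemma third_difference0 a :
    (forall n, a n.+3 = 3 * a n.+2 - 3 * a n.+1 + a n) ->
  forall n, a n = a 0%N + n%:R * (a 1%N - a 0%N)
    + n%:R * (n%:R - 1) / 2 * (a 2%N - 2 * a 1%N + a 0%N).
Proof.
move=> a3 n; pose f (t : R) := a 0%N + t * (a 1%N - a 0%N)
  + t * (t - 1) / 2 * (a 2%N - 2 * a 1%N + a 0%N).
suff : [/\ a n = f n%:R, a n.+1 = f n.+1%:R & a n.+2 = f n.+2%:R] by case.
elim: n => [|n [IH0 IH1 IH2]]; first by rewrite /f; split; field.
by split=> //; rewrite a3 IH0 IH1 IH2 /f -!(natr1 n.+2) -!(natr1 n.+1) -!(natr1 n); field.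
Qed.

Lemma natr_mul_pred_ge0 n : 0 <= n%:R * (n%:R - 1) :> R.
Proof. by case: n => [|n]; rewrite ?mul0r// -natr1 addrK mulr_ge0 ?addr_ge0. Qed.

Lemma bounded_multiples0 (c B : R) : (forall n, `|n%:R * c| <= B) -> c = 0.
Proof.
move=> cB; apply/eqP; rewrite -normr_le0; apply: (@archimedean_le0 _ _ B) => n.
by rewrite ler_pdivlMr ?ltr0n// mulrC -[n.+1%:R]normr_nat -normrM.
Qed.

(** The first differences of [a] are bounded and affine in [n], so their slope
    [c] is zero; then [a] itself is affine, so it is constant. *)
Lemma bounded_quadratic_const a B :
    (forall n, a n.+3 = 3 * a n.+2 - 3 * a n.+1 + a n) ->
    (forall n, `|a n| <= B) -> a 1%N = a 0%N.
Proof.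
move=> /third_difference0; set d := a 1%N - _; set c := _ + a 0%N => aE aB.
have c0 : c = 0.
  apply: (@bounded_multiples0 _ (B + B + (B + B))) => n.
  have -> : n%:R * c = (a n.+1 - a n) - (a 1%N - a 0%N).
    by rewrite (aE n.+1) (aE n) -natr1 -/d; field.
  by rewrite (le_trans (ler_normB _ _))// lerD// (le_trans (ler_normB _ _))// lerD.
apply/eqP; rewrite -subr_eq0; apply/eqP; apply: (@bounded_multiples0 _ (B + B)) => n.
have -> : n%:R * (a 1%N - a 0%N) = a n - a 0%N by rewrite (aE n) c0 -/d; ring.
by rewrite (le_trans (ler_normB _ _))// lerD.
Qed.

(** The bound is a square because it will be compared with squared norms. *)
Lemma quadratic_sqr_growth a :
    (forall n, a n.+3 = 3 * a n.+2 - 3 * a n.+1 + a n) ->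
  exists2 C, 0 < C & forall n, a n <= (C * n.+1%:R) ^+ 2.
Proof.
move=> /third_difference0; set d := a 1%N - _; set c := _ + a 0%N => aE.
pose C := 1 + `|a 0%N| + `|d| + `|c|.
have := normr_ge0 (a 0%N); have := normr_ge0 d; have := normr_ge0 c => c0 d0 a0.
have C1 : 1 <= C by rewrite /C; lra.
exists C => [|n]; first lra.
have n0 : 0 <= n%:R :> R by [].
have nn := natr_mul_pred_ge0 n.
rewrite aE -(natr1 n); move: n%:R n0 nn => t t0 tt.
have h0 := ler_norm (a 0%N); have h1 := ler_norm d; have h2 := ler_norm c.
have k1 : t * d <= t * `|d| by rewrite ler_wpM2l.
have k2 : t * (t - 1) / 2 * c <= t * (t - 1) / 2 * `|c| by rewrite ler_wpM2l// divr_ge0.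
apply: (@le_trans _ _ (C * (t + 1) ^+ 2)); last first.
  by rewrite exprMn ler_wpM2r ?sqr_ge0// expr2; nra.
rewrite /C; nra.
Qed.

(** If [b 1 > b 0], log-convexity propagates the ratio [1 + h = b 1 / b 0] to
    all later steps, so [b n >= (1 + h)^n b 0]; the quadratic terms of the
    binomial expansion already exceed any linear bound. *)
Lemma logconvex_linear_growth b C :
    (forall n, 0 <= b n) -> (forall n, b n.+1 ^+ 2 <= b n * b n.+2) ->
    (forall n, b n <= C * n.+1%:R) ->
  b 1%N <= b 0%N.
Proof.
move=> b0 bb bC; rewrite leNgt; apply/negP => b01.
have b00 : 0 < b 0%N.
  rewrite lt_neqAle b0 andbT; apply/eqP => b00.
  by have := bb 0%N; rewrite -b00 mul0r leNgt exprn_gt0// (le_lt_trans (b0 0%N)).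
pose h := b 1%N / b 0%N - 1.
have h0 : 0 < h by rewrite subr_gt0 ltr_pdivlMr ?mul1r.
have bS n : 0 < b n /\ (1 + h) * b n <= b n.+1.
  elim: n => [|n [bn IH]]; first by rewrite /h addrC subrK divfK ?gt_eqF.
  have bn1 : 0 < b n.+1 by nra.
  split => //; rewrite -(ler_pM2l bn); have := bb n; nra.
have lb n : b 0%N * (1 + n%:R * h + n%:R * (n%:R - 1) / 2 * h ^+ 2) <= b n.
  elim: n => [|n IH]; first by rewrite !mul0r !addr0 mulr1.
  have [_] := bS n; apply: le_trans.
  set p := b 0%N * _ in IH; apply: (@le_trans _ _ ((1 + h) * p)).
    rewrite -subr_ge0 -natr1 /p [leRHS](_ : _ =
        b 0%N * (n%:R * (n%:R - 1) / 2 * h ^+ 3)); last by field.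
    rewrite (mulr_ge0 (ltW b00))// (mulr_ge0 _ (exprn_ge0 _ (ltW h0)))//.
    by rewrite divr_ge0// natr_mul_pred_ge0.
  by rewrite ler_wpM2l//; lra.
(* At index [n + 2] the two bounds give
   [b 0 * (n + 2) (n + 1) / 2 * h^2 <= C (n + 3)], where [n + 3 <= 3 (n + 2) / 2]. *)
suff : b 0%N * h ^+ 2 <= 0 by rewrite leNgt mulr_gt0 ?exprn_gt0.
apply: (@archimedean_le0 _ _ (3 * C)) => n.
have := lb n.+2; have := bC n.+2; rewrite ler_pdivlMr ?ltr0n//.
rewrite -(natr1 n.+2) -(natr1 n.+1) -(natr1 n).
have : 0 <= n%:R :> R by []; move: n%:R => t t0 h1 h2.
have h3 := le_trans h2 h1.
have C0 : 0 <= C by have := bC 0%N; rewrite mulr1; apply: le_trans.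
have t2 : 0 < t + 2 by lra.
rewrite -(ler_pM2l t2).
have h4 : b 0%N * ((t + 2) * (t + 1) / 2 * h ^+ 2) <= C * (t + 1 + 1 + 1).
  apply: le_trans h3; rewrite ler_wpM2l ?(ltW b00)//.
  have : 0 <= (t + 2) * h by rewrite mulr_ge0// ltW.
  by nra.
nra.
Qed.
End Sequences.

(** * Orbits of 3-isometries and of normal operators *)

Section Operators.
Local Open Scope complex_scope.
Context {R : realType}.
Implicit Types H K L : hilbertType R.

Lemma rdot_iter_adjoint H (T : {linear H -> H}) : bounded_op T ->
  forall k x y, rdot x (iter k (adjoint T) y) = rdot (iter k T x) y.
Proof.
move=> Tb; elim=> // k IH x y.
by rewrite iterS -adjointP// IH -iterSr.
Qed.

(** Pair the defining equation, taken at [T^n x], with [T^n x] itself: each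
    [T^*k T^k] turns into a squared norm. *)
Lemma three_isometry_orbit H (T : {linear H -> H}) :
    bounded_op T -> m_isometry 3 T -> forall x n,
  rnorm (iter n.+3 T x) ^+ 2 = 3 * rnorm (iter n.+2 T x) ^+ 2
    - 3 * rnorm (iter n.+1 T x) ^+ 2 + rnorm (iter n T x) ^+ 2.
Proof.
move=> Tb T3 x n; set y := iter n T x.
have sgn k : (-1) ^+ k * 'C(3, k)%:R = ((-1) ^+ k * 'C(3, k)%:R : R)%:C :> R[i].
  by rewrite rmorphM rmorphXn/= rmorphN1 rmorph_nat.
have term k : rdot y (((-1) ^+ k * 'C(3, k)%:R) *: iter k (adjoint T) (iter k T y))
    = (-1) ^+ k * 'C(3, k)%:R * rnorm (iter k T y) ^+ 2.
  by rewrite sgn rdotZr rdot_iter_adjoint// rdotxx.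
have := congr1 (rdot y) (T3 y).
rewrite !big_nat_recr//= big_nil add0r !rdotDr.
rewrite (term 0%N) (term 1%N) (term 2%N) (term 3%N).
rewrite [rdot y 0]rdotC rdot0l -/y bin0 bin1 (_ : 'C(3, 2) = 3%N) // binn /=.
by move=> h; lra.
Qed.

(** [|N x|^2 = rdot x (N^* N x) <= |x| |N^* (N x)|], and [N^*] and [N] have the
    same norm on every vector. *)
Lemma normal_logconvex H (N : {linear H -> H}) : normal_op N ->
  forall x, rnorm (N x) ^+ 2 <= rnorm x * rnorm (N (N x)).
Proof.
move=> [Nb NN] x.
have NE z : rnorm (adjoint N z) = rnorm (N z).
  apply/eqP; rewrite -(eqrXn2 (_ : 0 < 2)%N) ?rnorm_ge0// -!rdotxx.
  by rewrite -adjointP// NN rdotC -adjointP.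
rewrite -rdotxx adjointP// -NE.
exact: le_trans (ler_norm _) (CauchySchwarz_rdot _ _).
Qed.

End Operators.

Theorem corollary2p1p6 (R : realType) (H : hilbertType R) (T : {linear H -> H})
    (T_bounded : bounded_op T) (T_3iso : m_isometry 3 T)
    (T_not_iso : ~ isometry_op T) :
  forall (K : hilbertType R) (S : {linear K -> K}),
    bounded_op S -> subnormal_op S -> ~ similar_op T S.
Proof.
move=> K S _ [L [J [N [Jiso Nnormal NJ]]]] [X [Xb Xbij XT]].
apply: T_not_iso => x; rewrite !normE; congr (real_complex _).
have [c c0 cX] := bounded_inverse Xb Xbij.
have [M M0 MX] := bounded_opP Xb.
have rJ y : rnorm (J y) = rnorm y by rewrite /rnorm Jiso.
have orbit n y : iter n N (J (X y)) = J (X (iter n T y)).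
  by elim: n => //= n ->; rewrite NJ XT.
(* [n |-> |N^n J X y|] is log-convex of linear growth; compare its
   first terms. *)
have contr y : rnorm (X (T y)) <= rnorm (X y).
  have [C C0 CT] := quadratic_sqr_growth (three_isometry_orbit T_bounded T_3iso y).
  rewrite XT -!rJ -NJ.
  apply: (@logconvex_linear_growth R (fun n => rnorm (iter n N (J (X y)))) (M * C)).
  - by move=> n; exact: rnorm_ge0.
  - by move=> n; exact: normal_logconvex.
  - move=> n; rewrite orbit rJ (le_trans (MX _))// -mulrA ler_pM2l//.
    by rewrite -ler_sqr ?nnegrE ?rnorm_ge0// mulr_ge0// ltW.
have bd n : rnorm (iter n T x) <= c * rnorm (X x).
  rewrite (le_trans (cX _))// ler_pM2l//.
  by elim: n => //= n; apply: le_trans.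
have := @bounded_quadratic_const R _ ((c * rnorm (X x)) ^+ 2)
  (three_isometry_orbit T_bounded T_3iso x).
move=> /(_ _)/= h; apply/eqP.
rewrite -(eqrXn2 (_ : 0 < 2)%N) ?rnorm_ge0//; apply/eqP/h => n.
rewrite ger0_norm ?sqr_ge0// ler_sqr ?nnegrE ?rnorm_ge0//.
exact: le_trans (rnorm_ge0 _) (bd 0%N).
Qed.
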